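(* Let $F>0$, let $1<K<N$ be integers, $\varepsilon=1/N$, and let $y_F$ be the straight chain with nearest neighbor interatomic spacing $F\varepsilon$. Given $f\in\mathcal U$, let $u^{\mathrm a},u^{\mathrm{QNL}}\in\mathcal U$ satisfy $$\delta\mathcal E^{\mathrm a}(y_F)[v]+\delta^2\mathcal E^{\mathrm a}(y_F)[u^{\mathrm a},v]=\langle f,v\rangle\quad\text{and}\quad\delta\mathcal E^{\mathrm{QNL}}(y_F)[v]+\delta^2\mathcal E^{\mathrm{QNL}}(y_F)[u^{\mathrm{QNL}},v]=\langle f,v\rangle$$ for all $v\in\mathcal U$. If $\phi'(2F)\ge0$, $\phi''(2F)\le0$, and $$\gamma_4:=\min\left\{\phi''(F)+4\,\phi''(2F),\ \frac{\phi'(F)}{F}\right\}>0,$$ then $$\|(u^{\mathrm a}-u^{\mathrm{QNL}})'\|_{\ell^2_\varepsilon}\le C\varepsilon\left[\left(\varepsilon\|(u^{\mathrm a})''_1\|^2+\varepsilon\|(u^{\mathrm a})''_{K+2}\|^2\right)^{1/2}+\varepsilon\left(\varepsilon\sum_{\ell=K+2}^N\|(u^{\mathrm a})'''_{\ell+1}\|^2\right)^{1/2}\right],$$ where $$C=\gamma_4^{-1}\max\left\{|\phi''(2F)|,\left|\frac{\phi'(2F)}{2F}\right|\right\}.$$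
   Context: Let $\varepsilon=1/N$. $\mathcal Y$ is the set of sequences $y=\{y_\ell\}_{\ell\in\mathbb Z}$, $y_\ell\in\mathbb R^2$, with $y_{\ell+N}=y_\ell+(y_N-y_0)$ for all $\ell$. $\mathcal U$ is the set of $N$-periodic sequences $u$ in $\mathbb R^2$ with $\sum_{\ell=1}^N u_\ell=0$. Backward differences: $y'_\ell=(y_\ell-y_{\ell-1})/\varepsilon$, $y^{(n)}_\ell=(y^{(n-1)}_\ell-y^{(n-1)}_{\ell-1})/\varepsilon$. $\|\cdot\|$ is the Euclidean norm; $\langle v,w\rangle=\varepsilon\sum_{\ell=1}^N v_\ell\cdot w_\ell$, $\|v\|_{\ell^2_\varepsilon}=\langle v,v\rangle^{1/2}$. The pair potential $\phi:(0,\infty)\to\mathbb R$ is twice continuously differentiable. Energies: $\mathcal E^{\mathrm a}(y)=\varepsilon\sum_{\ell=1}^N[\phi(\|y'_\ell\|)+\phi(\|y'_{\ell+1}+y'_\ell\|)]$ and $$\mathcal E^{\mathrm{QNL}}(y)=\varepsilon\sum_{\ell=1}^N\phi(\|y'_\ell\|)+\varepsilon\sum_{\ell=1}^K\phi(\|y'_{\ell+1}+y'_\ell\|)+\varepsilon\sum_{\ell=K+1}^N\tfrac12\left(\phi(2\|y'_\ell\|)+\phi(2\|y'_{\ell+1}\|)\right).$$ First and second variations: $\delta\mathcal E(y)[u]=\frac{d}{dt}\mathcal E(y+tu)|_{t=0}$, $\delta^2\mathcal E(y)[u,v]=\frac{\partial^2}{\partial s\partial t}\mathcal E(y+su+tv)|_{s=t=0}$.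 The straight chain is $(y_F)_\ell=(F\varepsilon\ell,0)$ (up to translation along the line). *)

(* Defs.v *)
From Stdlib Require Import Reals ZArith.
From Coquelicot Require Import Coquelicot.
Open Scope R_scope.

(* The library norm on this product is sqrt (|x|^2 + |y|^2), that is, the
   Euclidean norm; see [norm_R2]. *)
Definition R2 : NormedModule R_AbsRing :=
  prod_NormedModule R_AbsRing R_NormedModule R_NormedModule.

Definition chain : Type := Z -> R2.

Definition dot (a b : R2) : R := fst a * fst b + snd a * snd b.

Lemma norm_R2 (a : R2) : norm a = sqrt (dot a a).
Proof.
  destruct a as [a1 a2].
  change (sqrt (Rabs a1 ^ 2 + Rabs a2 ^ 2) = sqrt (a1 * a1 + a2 * a2)).
  f_equal.
  rewrite !pow2_abs; ring.
Qed.

Definition cplus (y u : chain) : chain := fun l => plus (y l) (u l).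
Definition cminus (y u : chain) : chain := fun l => minus (y l) (u l).
Definition cscal (t : R) (u : chain) : chain := fun l => scal t (u l).

Definition eps (N : nat) : R := / INR N.

Definition sumZ (f : Z -> R) (m n : nat) : R :=
  sum_n_m (fun l => f (Z.of_nat l)) m n.

Definition in_Y (N : nat) (y : chain) : Prop :=
  forall l : Z,
    y (l + Z.of_nat N)%Z = plus (y l) (minus (y (Z.of_nat N)) (y 0%Z)).

Definition in_U (N : nat) (u : chain) : Prop :=
  (forall l : Z, u (l + Z.of_nat N)%Z = u l) /\
  sum_n_m (fun l => u (Z.of_nat l)) 1 N = zero.

Definition bdiff (N : nat) (w : chain) : chain :=
  fun l => scal (/ eps N) (minus (w l) (w (l - 1)%Z)).

Definition bdiffn (N n : nat) (w : chain) : chain := Nat.iter n (bdiff N) w.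

Definition inner (N : nat) (v w : chain) : R :=
  eps N * sumZ (fun l => dot (v l) (w l)) 1 N.

Definition l2norm (N : nat) (v : chain) : R := sqrt (inner N v v).

(* Only the values of [phi] on (0, +oo) are constrained; the others are never
   seen by the variations at a chain whose bonds are all nonzero. *)
Definition C2_pos (phi : R -> R) : Prop :=
  forall x : R, 0 < x ->
    ex_derive phi x /\ ex_derive (Derive phi) x /\
    continuous (Derive_n phi 2) x.

Definition Ea (N : nat) (phi : R -> R) (y : chain) : R :=
  let y' := bdiff N y in
  eps N * sumZ (fun l => phi (norm (y' l))
                         + phi (norm (plus (y' (l + 1)%Z) (y' l)))) 1 N.

Definition EQNL (N K : nat) (phi : R -> R) (y : chain) : R :=
  let y' := bdiff N y in
  eps N * sumZ (fun l => phi (norm (y' l))) 1 N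
  + eps N * sumZ (fun l => phi (norm (plus (y' (l + 1)%Z) (y' l)))) 1 K
  + eps N * sumZ (fun l => / 2 * (phi (2 * norm (y' l))
                                  + phi (2 * norm (y' (l + 1)%Z)))) (K + 1) N.

Definition var1 (E : chain -> R) (y u : chain) : R :=
  Derive (fun t => E (cplus y (cscal t u))) 0.

Definition var2 (E : chain -> R) (y u v : chain) : R :=
  Derive (fun s =>
    Derive (fun t => E (cplus (cplus y (cscal s u)) (cscal t v))) 0) 0.

(* [c] is the arbitrary translation along the line. *)
Definition straight_chain (N : nat) (F c : R) : chain :=
  fun l => (F * eps N * IZR l + c, 0).

Definition gamma4 (phi : R -> R) (F : R) : R :=
  Rmin (Derive_n phi 2 F + 4 * Derive_n phi 2 (2 * F)) (Derive phi F / F).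

Definition Cconst (phi : R -> R) (F : R) : R :=
  / gamma4 phi F *
  Rmax (Rabs (Derive_n phi 2 (2 * F))) (Rabs (Derive phi (2 * F) / (2 * F))).

Lemma straight_chain_Y (N : nat) (F c : R) : in_Y N (straight_chain N F c).
Proof.
  intros l; unfold straight_chain; rewrite plus_IZR.
  apply injective_projections; unfold plus, minus, opp; simpl;
    unfold plus, opp; simpl; ring.
Qed.

Lemma in_Y_perturb (N : nat) (y u : chain) (t : R) :
  in_Y N y -> in_U N u -> in_Y N (cplus y (cscal t u)).
Proof.
  intros Hy [Hu _] l; unfold cplus, cscal.
  rewrite Hy, Hu.
  assert (H0 : u (Z.of_nat N) = u 0%Z) by apply (Hu 0%Z).
  rewrite H0.
  apply injective_projections; unfold minus, plus, opp, scal; simpl;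
    unfold plus, opp, scal; simpl; ring.
Qed.

(* Main.v *)
(** Both first variations vanish at the straight chain, so the error
    e = u^a - u^QNL solves H^QNL(e, v) = (H^QNL - H^a)(u^a, v) for all v, where
    H denotes the Hessian at y_F.  In the longitudinal component the
    parallelogram identity (a + b)^2 = 2 (a^2 + b^2) - (a - b)^2 and
    phi''(2F) <= 0 bound the next-nearest neighbour terms of H^QNL(e, e) from
    below by 4 phi''(2F) |e_1'|^2; in the transverse component they are
    nonnegative because phi'(2F) >= 0.  Hence H^QNL(e, e) >= gamma_4 |e'|^2.
    Polarizing the same identity, the right-hand side is
    eps^3 sum_(l = K+1)^N of the (2F)-stiffness of u''_(l+1) and v''_(l+1);
    one summation by parts moves a difference off v'' and leaves the two
    interface terms u''_1, u''_(K+2) and the sum of u''', and Cauchy-Schwarz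
    with v = e concludes. *)

Require Import Defs.
From Stdlib Require Import Reals ZArith Lra Lia FunctionalExtensionality.
From Coquelicot Require Import Coquelicot.
Open Scope R_scope.

(** * Mixed second derivatives of two-parameter families at the origin *)

(* [d s] is the [t]-derivative of [G s] at [0]; it is only required near
   [s = 0], since for large [s] a perturbed bond may vanish. *)
Definition second_order_at_0 (G : R -> R -> R) (D1 D2 : R) : Prop :=
  exists d : R -> R,
    locally 0 (fun s => is_derive (G s) 0 (d s)) /\
    d 0 = D1 /\ is_derive d 0 D2.

Lemma second_order_ext (G H : R -> R -> R) (D1 D2 : R) :
  (forall s t, G s t = H s t) ->
  second_order_at_0 G D1 D2 -> second_order_at_0 H D1 D2.
Proof.
  intros E [d [Hd [H1 H2]]]; exists d; split; [|now split].
  apply (filter_imp _ _ (fun s Hs => is_derive_ext _ _ _ _ (E s) Hs) Hd).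
Qed.

Lemma second_order_plus (G H : R -> R -> R) (D1 D2 E1 E2 : R) :
  second_order_at_0 G D1 D2 -> second_order_at_0 H E1 E2 ->
  second_order_at_0 (fun s t => G s t + H s t) (D1 + E1) (D2 + E2).
Proof.
  intros [d [Hd [Hd1 Hd2]]] [e [He [He1 He2]]].
  exists (fun s => d s + e s); split; [|split].
  - generalize (filter_and _ _ Hd He); apply filter_imp; intros s [A B].
    exact (is_derive_plus _ _ _ _ _ A B).
  - now rewrite Hd1, He1.
  - exact (is_derive_plus _ _ _ _ _ Hd2 He2).
Qed.

Lemma second_order_scal (k : R) (G : R -> R -> R) (D1 D2 : R) :
  second_order_at_0 G D1 D2 ->
  second_order_at_0 (fun s t => k * G s t) (k * D1) (k * D2).
Proof.
  intros [d [Hd [Hd1 Hd2]]].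
  exists (fun s => k * d s); split; [|split].
  - revert Hd; apply filter_imp; intros s A.
    exact (is_derive_scal _ _ k _ A).
  - now rewrite Hd1.
  - exact (is_derive_scal _ _ k _ Hd2).
Qed.

Lemma second_order_zero : second_order_at_0 (fun _ _ => 0) 0 0.
Proof.
  exists (fun _ => 0); split; [|split; [easy|]].
  - apply filter_forall; intros s; exact (is_derive_const _ _).
  - exact (is_derive_const _ _).
Qed.

(** * Finite sums, telescoping and shifts over a period *)

Lemma sumZ_empty (f : Z -> R) (m n : nat) : (n < m)%nat -> sumZ f m n = 0.
Proof. intros H; exact (sum_n_m_zero _ _ _ H). Qed.

Lemma sumZ_last (f : Z -> R) (m n : nat) :
  (m <= S n)%nat -> sumZ f m (S n) = sumZ f m n + f (Z.of_nat (S n)).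
Proof. intros H; exact (sum_n_Sm _ _ _ H). Qed.

Lemma sumZ_ext (f g : Z -> R) (m n : nat) :
  (forall l, f l = g l) -> sumZ f m n = sumZ g m n.
Proof. intros H; apply sum_n_m_ext; intros; apply H. Qed.

Lemma sumZ_plus (f g : Z -> R) (m n : nat) :
  sumZ (fun l => f l + g l) m n = sumZ f m n + sumZ g m n.
Proof. exact (sum_n_m_plus _ _ m n). Qed.

Lemma sumZ_scal (k : R) (f : Z -> R) (m n : nat) :
  sumZ (fun l => k * f l) m n = k * sumZ f m n.
Proof. exact (sum_n_m_mult_l k _ m n). Qed.

Lemma sumZ_minus (f g : Z -> R) (m n : nat) :
  sumZ (fun l => f l - g l) m n = sumZ f m n - sumZ g m n.
Proof.
  replace (sumZ f m n - sumZ g m n) with (sumZ f m n + (-1) * sumZ g m n) by ring.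
  rewrite <- sumZ_scal, <- sumZ_plus; apply sumZ_ext; intros; ring.
Qed.

Lemma sumZ_le (f g : Z -> R) (m n : nat) :
  (forall l, f l <= g l) -> sumZ f m n <= sumZ g m n.
Proof. intros H; apply sum_n_m_le; intros; apply H. Qed.

Lemma sumZ_nonneg (f : Z -> R) (m n : nat) :
  (forall l, 0 <= f l) -> 0 <= sumZ f m n.
Proof.
  intros H; apply Rle_trans with (sumZ (fun l => 0 * f l) m n).
  - rewrite sumZ_scal; lra.
  - apply sumZ_le; intros l; rewrite Rmult_0_l; apply H.
Qed.

Lemma sumZ_split (f : Z -> R) (m k n : nat) :
  (m <= S k)%nat -> (k <= n)%nat ->
  sumZ f m n = sumZ f m k + sumZ f (k + 1) n.
Proof. intros H1 H2; rewrite Nat.add_1_r; exact (sum_n_m_Chasles _ _ _ _ H1 H2). Qed.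

Lemma sumZ_telescope (f : Z -> R) (m n : nat) :
  (m <= n + 1)%nat ->
  sumZ (fun l => f (l + 1)%Z - f l) m n = f (Z.of_nat n + 1)%Z - f (Z.of_nat m).
Proof.
  induction n as [|n IH]; intros H.
  - destruct (Nat.eq_dec m 1) as [->|].
    + rewrite sumZ_empty by lia; simpl; ring.
    + replace m with 0%nat by lia; unfold sumZ; now rewrite sum_n_n.
  - destruct (Nat.eq_dec m (S n + 1)) as [->|].
    + rewrite sumZ_empty by lia.
      replace (Z.of_nat (S n + 1)) with (Z.of_nat (S n) + 1)%Z by lia; ring.
    + rewrite sumZ_last, IH by lia.
      replace (Z.of_nat (S n)) with (Z.of_nat n + 1)%Z by lia; ring.
Qed.

(** The difference of the two sums telescopes to [f (N + 1) - f 1]. *)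
Lemma sumZ_shift (N : nat) (f : Z -> R) :
  f (Z.of_nat N + 1)%Z = f 1%Z ->
  sumZ (fun l => f (l + 1)%Z) 1 N = sumZ f 1 N.
Proof.
  intros H; apply Rminus_diag_uniq.
  rewrite <- sumZ_minus, sumZ_telescope by lia; simpl; lra.
Qed.

Lemma second_order_sumZ (G : Z -> R -> R -> R) (D1 D2 : Z -> R) (m n : nat) :
  (forall l, second_order_at_0 (G l) (D1 l) (D2 l)) ->
  second_order_at_0 (fun s t => sumZ (fun l => G l s t) m n)
    (sumZ D1 m n) (sumZ D2 m n).
Proof.
  intros H; induction n as [|n IH].
  - destruct m as [|m].
    + unfold sumZ; rewrite !sum_n_n.
      apply (second_order_ext (G 0%Z)); [|exact (H 0%Z)].
      now intros s t; rewrite sum_n_n.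
    + rewrite !sumZ_empty by lia.
      apply (second_order_ext (fun _ _ => 0)); [|exact second_order_zero].
      now intros s t; rewrite sumZ_empty by lia.
  - destruct (Nat.le_gt_cases m (S n)) as [Hm|Hm].
    + rewrite !sumZ_last by lia.
      eapply second_order_ext; [|exact (second_order_plus _ _ _ _ _ _ IH (H _))].
      now intros s t; rewrite sumZ_last by lia.
    + rewrite !sumZ_empty by lia.
      apply (second_order_ext (fun _ _ => 0)); [|exact second_order_zero].
      now intros s t; rewrite sumZ_empty by lia.
Qed.

Ltac unfold_R2 :=
  unfold cplus, cminus, cscal, minus, plus, opp, scal; simpl;
  unfold minus, plus, opp, scal; simpl; unfold mult; simpl.

(** * Variations of an energy and the expansion of a single bond *)

(** At [s = 0] the inner derivative is the first variation. The outer derivative sees the inner one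
    only near [s = 0], which is where [d] is known to represent it. *)
Lemma variations_of_second_order (E : chain -> R) (y u v : chain) (D1 D2 : R) :
  second_order_at_0 (fun s t => E (cplus (cplus y (cscal s u)) (cscal t v))) D1 D2 ->
  var1 E y v = D1 /\ var2 E y u v = D2.
Proof.
  intros [d [Hd [H1 H2]]]; split.
  - rewrite <- H1; apply is_derive_unique.
    generalize (locally_singleton _ _ Hd).
    apply is_derive_ext; intros t; f_equal.
    apply functional_extensionality; intros l; unfold cplus, cscal.
    apply injective_projections; unfold_R2; ring.
  - unfold var2.
    rewrite (Derive_ext_loc _ d); [now apply is_derive_unique|].
    revert Hd; apply filter_imp; intros s Hs; now apply is_derive_unique.
Qed.

(** The bond [(r, 0)] displaced by [s a + t b]; every bond of the straight chain lies along the
    first axis. *)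
Definition perturbed_bond (r : R) (a b : R2) (s t : R) : R2 :=
  (r + s * fst a + t * fst b, s * snd a + t * snd b).

(* The Hessian of [z |-> phi |z|] at [(r, 0)]. *)
Definition stiffness (phi : R -> R) (r : R) (a b : R2) : R :=
  Derive_n phi 2 r * (fst a * fst b) + Derive phi r / r * (snd a * snd b).

(** The derivative of [phi |z|] along [b] is [phi'(|z|) (z . b) / |z|]. Differentiating it along [a]
    at [z = (r, 0)] gives [phi''] in the longitudinal component, while in the transverse one only
    the rotation of [z / |z|] contributes, with factor [phi'(r) / r]. *)
Lemma second_order_bond (phi : R -> R) (r : R) (a b : R2) :
  C2_pos phi -> 0 < r ->
  second_order_at_0 (fun s t => phi (norm (perturbed_bond r a b s t)))
    (Derive phi r * fst b) (stiffness phi r a b).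
Proof.
  intros Hphi Hr.
  apply (second_order_ext (fun s t =>
    phi (sqrt ((r + s * fst a + t * fst b) * (r + s * fst a + t * fst b)
               + (s * snd a + t * snd b) * (s * snd a + t * snd b))))).
  { now intros s t; rewrite norm_R2. }
  assert (Hsq : sqrt (r * r) = r) by (apply sqrt_square; lra).
  unfold stiffness.
  destruct a as [a1 a2], b as [b1 b2]; cbn [fst snd].
  (* The directional derivative along [b] at the bond [z = (r + s a1, s a2)]. *)
  exists (fun s => Derive phi (sqrt ((r + s * a1) * (r + s * a1) + (s * a2) * (s * a2)))
      * (((r + s * a1) * b1 + (s * a2) * b2)
         / sqrt ((r + s * a1) * (r + s * a1) + (s * a2) * (s * a2)))).
  split; [|split].
  (* For small [s] the first component stays positive, so the bond avoids the origin, where neither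
     [sqrt] nor [phi] is under control. *)
  - assert (HL : locally 0 (fun s => 0 < r + s * a1)).
    { apply (ex_derive_continuous (fun s : R => r + s * a1) 0 ltac:(auto_derive; easy)
               (fun z : R => 0 < z)).
      apply open_gt; lra. }
    revert HL; apply filter_imp; intros s Hs.
    assert (Hq : 0 < (r + s * a1) * (r + s * a1) + s * a2 * (s * a2)) by nra.
    assert (Hq' : 0 < sqrt ((r + s * a1) * (r + s * a1) + s * a2 * (s * a2)))
      by now apply sqrt_lt_R0.
    destruct (Hphi _ Hq') as [Hphi1 _].
    auto_derive.
    + replace ((r + s * a1 + 0 * b1) * (r + s * a1 + 0 * b1) +
        (s * a2 + 0 * b2) * (s * a2 + 0 * b2))
        with ((r + s * a1) * (r + s * a1) + s * a2 * (s * a2)) by ring.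
      now repeat split.
    + replace ((r + s * a1 + 0 * b1) * (r + s * a1 + 0 * b1) +
        (s * a2 + 0 * b2) * (s * a2 + 0 * b2))
        with ((r + s * a1) * (r + s * a1) + s * a2 * (s * a2)) by ring.
      replace (fun x : R => phi x) with phi by reflexivity.
      field; lra.
  - replace ((r + 0 * a1) * (r + 0 * a1) + 0 * a2 * (0 * a2)) with (r * r) by ring.
    rewrite Hsq; field; lra.
  - destruct (Hphi _ Hr) as [_ [Hphi2 _]].
    change (Derive_n phi 2 r) with (Derive (Derive phi) r).
    (* From here on only the differentiability of [phi'] at [r] matters, so [phi'] becomes an
       arbitrary function. *)
    set (psi := Derive phi) in *; clearbody psi.
    auto_derive;
      replace ((r + 0 * a1) * (r + 0 * a1) + 0 * a2 * (0 * a2)) with (r * r) by ring;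
      rewrite !Hsq.
    + repeat split; try lra; try nra; assumption.
    + change (fun x : R => psi x) with psi.
      field; lra.
Qed.

(** * Hessians of both energies at the straight chain *)

Lemma eps_pos (N : nat) : (0 < N)%nat -> 0 < eps N.
Proof. intros H; apply Rinv_0_lt_compat; now apply lt_0_INR. Qed.

Lemma bdiff_straight_chain (N : nat) (F c s t : R) (u v : chain) (l : Z) :
  (0 < N)%nat ->
  bdiff N (cplus (cplus (straight_chain N F c) (cscal s u)) (cscal t v)) l
  = perturbed_bond F (bdiff N u l) (bdiff N v l) s t.
Proof.
  intros HN; pose proof (eps_pos N HN).
  unfold bdiff, straight_chain, perturbed_bond.
  apply injective_projections; unfold_R2; rewrite ?minus_IZR; field; lra.
Qed.

Lemma plus_perturbed_bond (r : R) (a b a' b' : R2) (s t : R) :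
  plus (perturbed_bond r a b s t) (perturbed_bond r a' b' s t)
  = perturbed_bond (2 * r) (plus a a') (plus b b') s t.
Proof.
  unfold perturbed_bond.
  apply injective_projections; unfold_R2; ring.
Qed.

(** Recasts the local terms [phi (2 |y'|)] of the quasi-nonlocal energy as energies of bonds of
    length [2 r], so that [second_order_bond] covers them too. *)
Lemma norm_double_perturbed_bond (r : R) (a b : R2) (s t : R) :
  2 * norm (perturbed_bond r a b s t)
  = norm (perturbed_bond (2 * r) (plus a a) (plus b b) s t).
Proof.
  rewrite <- plus_perturbed_bond, !norm_R2.
  set (z := perturbed_bond r a b s t).
  replace (dot (plus z z) (plus z z)) with ((2 * 2) * dot z z)
    by (unfold dot; unfold_R2; ring).
  rewrite sqrt_mult_alt by lra; now rewrite sqrt_square by lra.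
Qed.

Definition hess_a (N : nat) (phi : R -> R) (F : R) (u v : chain) : R :=
  let u' := bdiff N u in let v' := bdiff N v in
  eps N * sumZ (fun l => stiffness phi F (u' l) (v' l)
    + stiffness phi (2 * F) (plus (u' (l + 1)%Z) (u' l)) (plus (v' (l + 1)%Z) (v' l))) 1 N.

Definition hess_qnl (N K : nat) (phi : R -> R) (F : R) (u v : chain) : R :=
  let u' := bdiff N u in let v' := bdiff N v in
  eps N * sumZ (fun l => stiffness phi F (u' l) (v' l)) 1 N
  + eps N * sumZ (fun l => stiffness phi (2 * F)
      (plus (u' (l + 1)%Z) (u' l)) (plus (v' (l + 1)%Z) (v' l))) 1 K
  + eps N * sumZ (fun l => / 2 *
      (stiffness phi (2 * F) (plus (u' l) (u' l)) (plus (v' l) (v' l))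
       + stiffness phi (2 * F) (plus (u' (l + 1)%Z) (u' (l + 1)%Z))
           (plus (v' (l + 1)%Z) (v' (l + 1)%Z)))) (K + 1) N.

Lemma second_order_Ea (phi : R -> R) (N : nat) (F c : R) (u v : chain) :
  C2_pos phi -> 0 < F -> (0 < N)%nat ->
  second_order_at_0
    (fun s t => Ea N phi
       (cplus (cplus (straight_chain N F c) (cscal s u)) (cscal t v)))
    (eps N * sumZ (fun l => Derive phi F * fst (bdiff N v l)
       + Derive phi (2 * F) * fst (plus (bdiff N v (l + 1)%Z) (bdiff N v l))) 1 N)
    (hess_a N phi F u v).
Proof.
  intros Hphi HF HN.
  eapply second_order_ext; cycle 1.
  - apply second_order_scal, second_order_sumZ; intros l.
    apply second_order_plus; apply second_order_bond; try assumption; lra.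
  - intros s t; cbv beta; unfold Ea; f_equal; apply sumZ_ext; intros l.
    now rewrite !bdiff_straight_chain, plus_perturbed_bond by exact HN.
Qed.

Lemma second_order_EQNL (phi : R -> R) (N K : nat) (F c : R) (u v : chain) :
  C2_pos phi -> 0 < F -> (0 < N)%nat ->
  second_order_at_0
    (fun s t => EQNL N K phi
       (cplus (cplus (straight_chain N F c) (cscal s u)) (cscal t v)))
    (eps N * sumZ (fun l => Derive phi F * fst (bdiff N v l)) 1 N
     + eps N * sumZ (fun l =>
         Derive phi (2 * F) * fst (plus (bdiff N v (l + 1)%Z) (bdiff N v l))) 1 K
     + eps N * sumZ (fun l => / 2 *
         (Derive phi (2 * F) * fst (plus (bdiff N v l) (bdiff N v l))
          + Derive phi (2 * F)
            * fst (plus (bdiff N v (l + 1)%Z) (bdiff N v (l + 1)%Z)))) (K + 1) N)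
    (hess_qnl N K phi F u v).
Proof.
  intros Hphi HF HN.
  eapply second_order_ext; cycle 1.
  - apply second_order_plus; [apply second_order_plus|];
      apply second_order_scal, second_order_sumZ; intros l;
      [| |apply second_order_scal, second_order_plus];
      apply second_order_bond; try assumption; lra.
  - intros s t; cbv beta; unfold EQNL; f_equal; [f_equal|]; f_equal;
      apply sumZ_ext; intros l;
      rewrite !bdiff_straight_chain by exact HN.
    + reflexivity.
    + now rewrite plus_perturbed_bond.
    + now rewrite !norm_double_perturbed_bond.
Qed.

(** * Periodicity and equilibrium of the straight chain *)

Lemma bdiff_periodic (N : nat) (w : chain) :
  (forall l, w (l + Z.of_nat N)%Z = w l) ->
  forall l, bdiff N w (l + Z.of_nat N)%Z = bdiff N w l.
Proof.
  intros H l; unfold bdiff.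
  replace (l + Z.of_nat N - 1)%Z with (l - 1 + Z.of_nat N)%Z by lia.
  now rewrite !H.
Qed.

Lemma periodic_Sn {A : Type} (N : nat) (w : Z -> A) :
  (forall l, w (l + Z.of_nat N)%Z = w l) -> w (Z.of_nat N + 1)%Z = w 1%Z.
Proof. intros H; rewrite Z.add_comm; apply H. Qed.

Lemma sumZ_fst_bdiff (N : nat) (v : chain) :
  in_U N v -> sumZ (fun l => fst (bdiff N v l)) 1 N = 0.
Proof.
  intros [Hv _].
  (* Shifting the index by one turns backward differences into the forward ones that telescope; the
     ends are [v_N] and [v_0], equal by periodicity. *)
  pose (w := fun l : Z => / eps N * fst (v (l - 1)%Z)).
  rewrite (sumZ_ext _ (fun l => w (l + 1)%Z - w l)).
  - rewrite sumZ_telescope by lia; unfold w.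
    replace (Z.of_nat N + 1 - 1)%Z with (0 + Z.of_nat N)%Z by lia.
    rewrite Hv; simpl; ring.
  - intros l; unfold w; replace (l + 1 - 1)%Z with l by lia.
    unfold bdiff; unfold_R2; ring.
Qed.

(* The straight chain is an equilibrium of both models: its bonds carry a
   constant force, and [v'] has mean zero. *)
Lemma sumZ_first_variation (N : nat) (A B : R) (v : chain) :
  in_U N v ->
  sumZ (fun l => A * fst (bdiff N v l)
       + B * fst (plus (bdiff N v (l + 1)%Z) (bdiff N v l))) 1 N = 0.
Proof.
  intros Hv; pose proof (sumZ_fst_bdiff N v Hv) as H0.
  rewrite (sumZ_ext _ (fun l => (A * fst (bdiff N v l)
     + B * fst (bdiff N v (l + 1)%Z)) + B * fst (bdiff N v l)))
    by (intros l; unfold_R2; ring).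
  rewrite !sumZ_plus, !sumZ_scal.
  rewrite (sumZ_shift N (fun l => fst (bdiff N v l))).
  - rewrite H0; ring.
  - f_equal; apply periodic_Sn, bdiff_periodic, Hv.
Qed.

Lemma variations_Ea (phi : R -> R) (N : nat) (F c : R) (u v : chain) :
  C2_pos phi -> 0 < F -> (0 < N)%nat -> in_U N v ->
  var1 (Ea N phi) (straight_chain N F c) v
  + var2 (Ea N phi) (straight_chain N F c) u v = hess_a N phi F u v.
Proof.
  intros Hphi HF HN Hv.
  destruct (variations_of_second_order _ _ _ _ _ _
              (second_order_Ea phi N F c u v Hphi HF HN)) as [-> ->].
  rewrite sumZ_first_variation by exact Hv; ring.
Qed.

Lemma variations_EQNL (phi : R -> R) (N K : nat) (F c : R) (u v : chain) :
  C2_pos phi -> 0 < F -> (K < N)%nat -> in_U N v ->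
  var1 (EQNL N K phi) (straight_chain N F c) v
  + var2 (EQNL N K phi) (straight_chain N F c) u v = hess_qnl N K phi F u v.
Proof.
  intros Hphi HF HN Hv.
  destruct (variations_of_second_order _ _ _ _ _ _
              (second_order_EQNL phi N K F c u v Hphi HF ltac:(lia))) as [-> ->].
  (* To first order, half the sum of the two doubled bonds equals the true next-nearest neighbour
     term. Hence there are no ghost forces at the interface, and the two ranges merge into the
     atomistic sum. *)
  rewrite (sumZ_ext (fun l => / 2 * _)
    (fun l => Derive phi (2 * F) * fst (plus (bdiff N v (l + 1)%Z) (bdiff N v l))))
    by (intros l; generalize (bdiff N v); intros v'; unfold_R2; field).
  rewrite (Rplus_assoc (eps N * _) (eps N * _) (eps N * _)), <- Rmult_plus_distr_l, <- sumZ_split by lia.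
  rewrite <- Rmult_plus_distr_l, <- sumZ_plus.
  rewrite sumZ_first_variation by exact Hv; ring.
Qed.

(** * Linearity and coercivity of the quasi-nonlocal Hessian *)

Lemma bdiff_cminus (N : nat) (u v : chain) (l : Z) :
  bdiff N (cminus u v) l = minus (bdiff N u l) (bdiff N v l).
Proof. unfold bdiff; apply injective_projections; unfold_R2; ring. Qed.

Lemma hess_qnl_cminus (phi : R -> R) (N K : nat) (F : R) (u w v : chain) :
  hess_qnl N K phi F (cminus u w) v
  = hess_qnl N K phi F u v - hess_qnl N K phi F w v.
Proof.
  unfold hess_qnl.
  rewrite (sumZ_ext (fun l => stiffness phi F (bdiff N (cminus u w) l) _)
    (fun l => stiffness phi F (bdiff N u l) (bdiff N v l)
            - stiffness phi F (bdiff N w l) (bdiff N v l))).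
  2: intros l; rewrite bdiff_cminus; unfold stiffness; unfold_R2; ring.
  rewrite (sumZ_ext (fun l => stiffness phi (2 * F) _ _)
    (fun l => stiffness phi (2 * F) (plus (bdiff N u (l + 1)%Z) (bdiff N u l))
                (plus (bdiff N v (l + 1)%Z) (bdiff N v l))
            - stiffness phi (2 * F) (plus (bdiff N w (l + 1)%Z) (bdiff N w l))
                (plus (bdiff N v (l + 1)%Z) (bdiff N v l)))).
  2: intros l; rewrite !bdiff_cminus; unfold stiffness; unfold_R2; ring.
  rewrite (sumZ_ext (fun l => / 2 * _)
    (fun l => / 2 *
      (stiffness phi (2 * F) (plus (bdiff N u l) (bdiff N u l))
         (plus (bdiff N v l) (bdiff N v l))
       + stiffness phi (2 * F) (plus (bdiff N u (l + 1)%Z) (bdiff N u (l + 1)%Z))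
           (plus (bdiff N v (l + 1)%Z) (bdiff N v (l + 1)%Z)))
     - / 2 *
      (stiffness phi (2 * F) (plus (bdiff N w l) (bdiff N w l))
         (plus (bdiff N v l) (bdiff N v l))
       + stiffness phi (2 * F) (plus (bdiff N w (l + 1)%Z) (bdiff N w (l + 1)%Z))
           (plus (bdiff N v (l + 1)%Z) (bdiff N v (l + 1)%Z))))).
  2: intros l; rewrite !bdiff_cminus; unfold stiffness; unfold_R2; ring.
  rewrite !sumZ_minus; ring.
Qed.

Lemma dot_ge_0 (a : R2) : 0 <= dot a a.
Proof. unfold dot; nra. Qed.

Lemma sqr_norm_R2 (a : R2) : norm a ^ 2 = dot a a.
Proof.
  rewrite norm_R2; simpl; rewrite Rmult_1_r.
  apply sqrt_sqrt, dot_ge_0.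
Qed.

Lemma hess_qnl_coercive (phi : R -> R) (N K : nat) (F : R) (e : chain) :
  0 < F -> (K < N)%nat ->
  (forall l, e (l + Z.of_nat N)%Z = e l) ->
  0 <= Derive phi (2 * F) -> Derive_n phi 2 (2 * F) <= 0 ->
  gamma4 phi F * inner N (bdiff N e) (bdiff N e) <= hess_qnl N K phi F e e.
Proof.
  intros HF HKN He H1 H2.
  pose proof (eps_pos N ltac:(lia)) as Heps.
  pose proof (Rmin_l (Derive_n phi 2 F + 4 * Derive_n phi 2 (2 * F)) (Derive phi F / F)) as G1.
  pose proof (Rmin_r (Derive_n phi 2 F + 4 * Derive_n phi 2 (2 * F)) (Derive phi F / F)) as G2.
  fold (gamma4 phi F) in G1, G2.
  assert (HQ : 0 <= Derive phi (2 * F) / (2 * F)).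
  { apply Rmult_le_pos; [exact H1|apply Rlt_le, Rinv_0_lt_compat; lra]. }
  unfold hess_qnl, inner, stiffness.
  set (A := Derive_n phi 2 F) in *; set (B := Derive_n phi 2 (2 * F)) in *.
  set (P := Derive phi F / F) in *; set (Q := Derive phi (2 * F) / (2 * F)) in *.
  set (g := gamma4 phi F) in *; clearbody A B P Q g; clear H1.
  set (e' := bdiff N e).
  assert (He' : e' (Z.of_nat N + 1)%Z = e' 1%Z).
  { apply periodic_Sn; unfold e'; apply bdiff_periodic, He. }
  clearbody e'.
  rewrite <- !Rmult_plus_distr_l, <- Rmult_assoc, (Rmult_comm g), Rmult_assoc.
  apply Rmult_le_compat_l; [lra|].
  (* Half of [4 phi''(2F) |e_1'|^2]: each pair [(l, l + 1)] charges one half to either end, and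
     periodicity restores the full amount. *)
  set (h := fun l : Z => 2 * B * (fst (e' l) * fst (e' l))).
  assert (Hh : sumZ (fun l => h l + h (l + 1)%Z) 1 N = sumZ (fun l => 2 * h l) 1 N).
  { rewrite sumZ_plus, sumZ_scal, sumZ_shift; [ring|].
    unfold h; now rewrite He'. }
  apply Rle_trans with
    (sumZ (fun l => A * (fst (e' l) * fst (e' l)) + P * (snd (e' l) * snd (e' l))) 1 N
     + sumZ (fun l => h l + h (l + 1)%Z) 1 N).
  - rewrite Hh, <- sumZ_plus, <- sumZ_scal; apply sumZ_le; intros l.
    unfold h, dot; nra.
  - rewrite (sumZ_split (fun l => h l + h (l + 1)%Z) 1 K N) by lia.
    rewrite <- Rplus_assoc.
    apply Rplus_le_compat; [apply Rplus_le_compat_l|]; apply sumZ_le; intros l;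
      unfold h; unfold_R2.
    (* The right side minus the left is [- B (z1 - x1)^2 + Q (z2 + x2)^2]. *)
    + assert (Hnl : forall x1 x2 z1 z2 : R,
        2 * B * (x1 * x1) + 2 * B * (z1 * z1)
        <= B * ((z1 + x1) * (z1 + x1)) + Q * ((z2 + x2) * (z2 + x2))).
      { intros x1 x2 z1 z2.
        pose proof (Rmult_le_pos _ _ HQ (Rle_0_sqr (z2 + x2))) as H.
        pose proof (Rmult_le_pos (- B) _ ltac:(lra) (Rle_0_sqr (z1 - x1))) as H'.
        unfold Rsqr in H, H'; lra. }
      apply Hnl.
    (* The longitudinal parts agree exactly; the surplus is [2 Q (x2^2 + z2^2)]. *)
    + assert (Hloc : forall x1 x2 z1 z2 : R,
        2 * B * (x1 * x1) + 2 * B * (z1 * z1)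
        <= / 2 * (B * ((x1 + x1) * (x1 + x1)) + Q * ((x2 + x2) * (x2 + x2))
                  + (B * ((z1 + z1) * (z1 + z1)) + Q * ((z2 + z2) * (z2 + z2))))).
      { intros x1 x2 z1 z2.
        pose proof (Rmult_le_pos _ _ HQ (Rle_0_sqr x2)) as H.
        pose proof (Rmult_le_pos _ _ HQ (Rle_0_sqr z2)) as H'.
        unfold Rsqr in H, H'; lra. }
      apply Hloc.
Qed.

(** * Consistency error and summation by parts *)

Lemma hess_consistency (phi : R -> R) (N K : nat) (F : R) (u v : chain) :
  (K < N)%nat ->
  hess_qnl N K phi F u v - hess_a N phi F u v
  = eps N ^ 3 * sumZ (fun l => stiffness phi (2 * F)
      (bdiffn N 2 u (l + 1)%Z) (bdiffn N 2 v (l + 1)%Z)) (K + 1) N.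
Proof.
  intros HKN; pose proof (eps_pos N ltac:(lia)) as Heps.
  unfold hess_qnl, hess_a.
  rewrite sumZ_plus, (sumZ_split (fun l => stiffness phi (2 * F) _ _) 1 K N) by lia.
  (* The nearest neighbour terms and the pairs up to [K] cancel; [z] and [w] are the local and the
     true next-nearest terms over [K + 1 .. N]. *)
  match goal with
  | |- ?e * ?x + ?e * ?y + ?e * ?z - ?e * (?x + (?y + ?w)) = _ =>
      transitivity (e * (z - w)); [ring|]
  end.
  rewrite <- sumZ_minus.
  transitivity (eps N * sumZ (fun l => eps N ^ 2 * stiffness phi (2 * F)
      (bdiffn N 2 u (l + 1)%Z) (bdiffn N 2 v (l + 1)%Z)) (K + 1) N).
  2: rewrite sumZ_scal; ring.
  (* Componentwise this is [2 a b + 2 c d - (a + c) (b + d) = (c - a) (d - b)]; the two first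
     differences supply [eps^2]. *)
  f_equal; apply sumZ_ext; intros l.
  unfold bdiffn; cbn [Nat.iter nat_rect].
  generalize (bdiff N u), (bdiff N v); intros u' v'.
  unfold bdiff; replace (l + 1 - 1)%Z with l by lia.
  unfold stiffness; generalize (Derive phi (2 * F) / (2 * F)); intros Q.
  unfold_R2; field; lra.
Qed.

Lemma bdiffn_S (N n : nat) (w : chain) : bdiffn N (S n) w = bdiff N (bdiffn N n w).
Proof. reflexivity. Qed.

(** Abel summation for the bilinear form [stiffness]. The upper limit [n] is separate from [N], so
    that induction on it leaves [eps N] fixed. *)
Lemma summation_by_parts (phi : R -> R) (N K n : nat) (r : R) (a b : chain) :
  (0 < N)%nat -> (K < n)%nat ->
  eps N * sumZ (fun l => stiffness phi r (a (l + 1)%Z) (bdiff N b (l + 1)%Z)) (K + 1) n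
  = stiffness phi r (a (Z.of_nat n + 1)%Z) (b (Z.of_nat n + 1)%Z)
    - stiffness phi r (a (Z.of_nat K + 2)%Z) (b (Z.of_nat K + 1)%Z)
    - eps N * sumZ (fun l => stiffness phi r (bdiff N a (l + 1)%Z) (b l)) (K + 2) n.
Proof.
  intros HN HK; pose proof (eps_pos N HN) as Heps.
  assert (Hb : forall l x, eps N * stiffness phi r x (bdiff N b (l + 1)%Z)
                = stiffness phi r x (b (l + 1)%Z) - stiffness phi r x (b l)).
  { intros l x; unfold bdiff; replace (l + 1 - 1)%Z with l by lia.
    unfold stiffness; generalize (Derive phi r / r); intros Q.
    unfold_R2; field; lra. }
  assert (Ha : forall l x, eps N * stiffness phi r (bdiff N a (l + 1)%Z) x
                = stiffness phi r (a (l + 1)%Z) x - stiffness phi r (a l) x).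
  { intros l x; unfold bdiff; replace (l + 1 - 1)%Z with l by lia.
    unfold stiffness; generalize (Derive phi r / r); intros Q.
    unfold_R2; field; lra. }
  rewrite <- !sumZ_scal.
  rewrite (sumZ_ext _ _ (K + 1) n (fun l => Hb l _)).
  rewrite (sumZ_ext _ _ (K + 2) n (fun l => Ha l _)).
  (* Both summands are differences of [p] and [q]. The sum on the right starts one index later, so
     [q (K + 1)] survives as the left boundary term. *)
  pose (p := fun l => stiffness phi r (a l) (b l)).
  pose (q := fun l => stiffness phi r (a (l + 1)%Z) (b l)).
  change (sumZ (fun l => p (l + 1)%Z - q l) (K + 1) n
    = p (Z.of_nat n + 1)%Z - stiffness phi r (a (Z.of_nat K + 2)%Z) (b (Z.of_nat K + 1)%Z)
      - sumZ (fun l => q l - p l) (K + 2) n).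
  replace (stiffness phi r (a (Z.of_nat K + 2)%Z) (b (Z.of_nat K + 1)%Z))
    with (q (Z.of_nat K + 1)%Z)
    by (unfold q; do 2 f_equal; lia).
  induction n as [|n IH]; [lia|].
  destruct (Nat.eq_dec n K) as [->|Hn].
  - rewrite (sumZ_empty _ (K + 2)) by lia.
    rewrite sumZ_last, sumZ_empty by lia.
    replace (Z.of_nat (S K)) with (Z.of_nat K + 1)%Z by lia; ring.
  - rewrite !sumZ_last, IH by lia.
    replace (Z.of_nat (S n)) with (Z.of_nat n + 1)%Z by lia; ring.
Qed.

(** * Cauchy-Schwarz inequalities *)

(** Planar Cauchy-Schwarz for [(sqrt X, x)] and [(sqrt Y, y)]: the squares differ by
    [(a y - b x)^2]. In this form it is the induction step for sums. *)
Lemma cauchy_schwarz_step (X Y x y : R) :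
  0 <= X -> 0 <= Y ->
  sqrt X * sqrt Y + x * y <= sqrt (X + x ^ 2) * sqrt (Y + y ^ 2).
Proof.
  intros HX HY.
  apply Rsqr_incr_0_var; [|apply Rmult_le_pos; apply sqrt_pos].
  rewrite Rsqr_mult, !Rsqr_sqrt by nra.
  pose proof (sqrt_sqrt X HX) as EX; pose proof (sqrt_sqrt Y HY) as EY.
  set (a := sqrt X) in *; set (b := sqrt Y) in *; rewrite <- EX, <- EY.
  unfold Rsqr; pose proof (pow2_ge_0 (a * y - b * x)); nra.
Qed.

Lemma cauchy_schwarz_sumZ (f g : Z -> R) (m n : nat) :
  sumZ (fun l => f l * g l) m n
  <= sqrt (sumZ (fun l => f l ^ 2) m n) * sqrt (sumZ (fun l => g l ^ 2) m n).
Proof.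
  induction n as [|n IH].
  - destruct m as [|m].
    + unfold sumZ; rewrite !sum_n_n.
      pose proof (cauchy_schwarz_step 0 0 (f 0%Z) (g 0%Z) ltac:(lra) ltac:(lra)) as H.
      rewrite !sqrt_0, !Rplus_0_l in H; simpl in *; lra.
    + rewrite !sumZ_empty by lia; rewrite sqrt_0; lra.
  - destruct (Nat.le_gt_cases m (S n)) as [Hm|Hm].
    + rewrite !sumZ_last by lia.
      eapply Rle_trans; [apply Rplus_le_compat_r, IH|].
      apply cauchy_schwarz_step; apply sumZ_nonneg; intros; apply pow2_ge_0.
    + rewrite !sumZ_empty by lia; rewrite sqrt_0; lra.
Qed.

(** The form is diagonal with entries [phi''(r)] and [phi'(r) / r]; what remains is planar
    Cauchy-Schwarz for the absolute values of the components. *)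
Lemma stiffness_bound (phi : R -> R) (r : R) (a b : R2) :
  Rabs (stiffness phi r a b)
  <= Rmax (Rabs (Derive_n phi 2 r)) (Rabs (Derive phi r / r)) * (norm a * norm b).
Proof.
  unfold stiffness.
  set (B := Derive_n phi 2 r); set (Q := Derive phi r / r).
  pose proof (Rmax_l (Rabs B) (Rabs Q)) as M1; pose proof (Rmax_r (Rabs B) (Rabs Q)) as M2.
  set (M := Rmax (Rabs B) (Rabs Q)) in *; clearbody M B Q.
  assert (HM : 0 <= M) by (pose proof (Rabs_pos B); lra).
  destruct a as [a1 a2], b as [b1 b2]; cbn [fst snd].
  eapply Rle_trans; [apply Rabs_triang|].
  rewrite !(Rabs_mult B), !(Rabs_mult Q).
  apply Rle_trans with (M * (Rabs (a1 * b1) + Rabs (a2 * b2))).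
  - rewrite Rmult_plus_distr_l.
    apply Rplus_le_compat; apply Rmult_le_compat_r; auto using Rabs_pos.
  - apply Rmult_le_compat_l; [exact HM|].
    rewrite !norm_R2; unfold dot; cbn [fst snd]; rewrite !Rabs_mult.
    pose proof (cauchy_schwarz_step (a1 * a1) (b1 * b1) (Rabs a2) (Rabs b2)
                  ltac:(nra) ltac:(nra)) as H.
    rewrite !pow2_abs in H.
    change (a1 * a1) with (Rsqr a1) in *; change (b1 * b1) with (Rsqr b1) in *.
    rewrite !sqrt_Rsqr_abs in H; unfold Rsqr in *; simpl in H.
    now rewrite !Rmult_1_r in H.
Qed.

(** * Bound on the consistency error *)

Lemma in_U_cminus (N : nat) (u w : chain) :
  in_U N u -> in_U N w -> in_U N (cminus u w).
Proof.
  intros [Hu1 Hu2] [Hw1 Hw2]; split.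
  - intros l; unfold cminus; now rewrite Hu1, Hw1.
  - rewrite (sum_n_m_ext _ (fun l => plus (u (Z.of_nat l)) (scal (opp one) (w (Z.of_nat l))))).
    + rewrite sum_n_m_plus, Hu2.
      rewrite (sum_n_m_scal_l (opp one) (fun l => w (Z.of_nat l))).
      etransitivity; [apply f_equal, f_equal, Hw2|].
      exact (eq_trans (plus_zero_l _) (scal_zero_r _)).
    + intros l; unfold cminus, minus; now rewrite scal_opp_one.
Qed.

Lemma consistency_bound (phi : R -> R) (N K : nat) (F : R) (u v : chain) :
  (0 < K)%nat -> (K < N)%nat ->
  (forall l, u (l + Z.of_nat N)%Z = u l) ->
  (forall l, v (l + Z.of_nat N)%Z = v l) ->
  hess_qnl N K phi F u v - hess_a N phi F u v
  <= Rmax (Rabs (Derive_n phi 2 (2 * F))) (Rabs (Derive phi (2 * F) / (2 * F))) * eps N *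
     (sqrt (eps N * norm (bdiffn N 2 u 1%Z) ^ 2
            + eps N * norm (bdiffn N 2 u (Z.of_nat K + 2)%Z) ^ 2)
      + eps N *
        sqrt (eps N *
              sumZ (fun l => norm (bdiffn N 3 u (l + 1)%Z) ^ 2) (K + 2) N))
     * l2norm N (bdiff N v).
Proof.
  intros HK HKN Hu Hv.
  pose proof (eps_pos N ltac:(lia)) as Heps.
  rewrite hess_consistency by exact HKN.
  rewrite (bdiffn_S N 2 u).
  (* The right boundary of the summation by parts sits at [N + 1]; periodicity moves it to site
     [1]. *)
  assert (Hu2 : bdiffn N 2 u (Z.of_nat N + 1)%Z = bdiffn N 2 u 1%Z).
  { apply periodic_Sn; do 2 apply bdiff_periodic; exact Hu. }
  set (a := bdiffn N 2 u) in *; clearbody a.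
  change (bdiffn N 2 v) with (bdiff N (bdiff N v)).
  assert (Hv1 : bdiff N v (Z.of_nat N + 1)%Z = bdiff N v 1%Z).
  { apply periodic_Sn; apply bdiff_periodic; exact Hv. }
  set (b := bdiff N v) in *; clearbody b.
  replace (eps N ^ 3) with (eps N ^ 2 * eps N) by ring.
  rewrite Rmult_assoc, summation_by_parts, Hu2, Hv1 by lia.
  unfold l2norm, inner.
  set (h := eps N) in *.
  pose proof (stiffness_bound phi (2 * F)) as SB.
  set (M := Rmax _ _) in *.
  assert (HM : 0 <= M).
  { unfold M; eapply Rle_trans; [apply Rabs_pos|apply Rmax_l]. }
  set (S := sumZ (fun l => dot (b l) (b l)) 1 N).
  assert (HS : 0 <= S) by (apply sumZ_nonneg; intros; apply dot_ge_0).
  set (T := sumZ (fun l => norm (bdiff N a (l + 1)%Z) ^ 2) (K + 2) N).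
  assert (HT : 0 <= T) by (apply sumZ_nonneg; intros; apply pow2_ge_0).
  set (b1 := b 1%Z); set (bK := b (Z.of_nat K + 1)%Z).
  set (a1 := a 1%Z); set (aK := a (Z.of_nat K + 2)%Z).
  (* Sites [1] and [K + 1] are distinct and lie in [1 .. N] because [0 < K < N], so both values of
     [v'] fit into one copy of [S]. *)
  assert (Sends : norm b1 ^ 2 + norm bK ^ 2 <= S).
  { unfold S; rewrite (sumZ_split _ 1 1 N) by lia.
    rewrite (sumZ_split _ (1 + 1) K N), (sumZ_split _ (K + 1) (K + 1) N) by lia.
    assert (E1 : sumZ (fun l => dot (b l) (b l)) 1 1 = norm b1 ^ 2)
      by (rewrite sqr_norm_R2; exact (sum_n_n _ _)).
    assert (E2 : sumZ (fun l => dot (b l) (b l)) (K + 1) (K + 1) = norm bK ^ 2).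
    { rewrite sqr_norm_R2; unfold bK.
      replace (Z.of_nat K + 1)%Z with (Z.of_nat (K + 1)) by lia; exact (sum_n_n _ _). }
    rewrite E1, E2.
    pose proof (sumZ_nonneg (fun l => dot (b l) (b l)) (1 + 1) K (fun l => dot_ge_0 _)).
    pose proof (sumZ_nonneg (fun l => dot (b l) (b l)) (K + 1 + 1) N (fun l => dot_ge_0 _)).
    lra. }
  assert (Stail : sumZ (fun l => norm (b l) ^ 2) (K + 2) N <= S).
  { rewrite (sumZ_ext _ (fun l => dot (b l) (b l))) by (intros; apply sqr_norm_R2).
    unfold S; rewrite (sumZ_split _ 1 (K + 1) N) by lia.
    replace (K + 1 + 1)%nat with (K + 2)%nat by lia.
    pose proof (sumZ_nonneg (fun l => dot (b l) (b l)) 1 (K + 1) (fun l => dot_ge_0 _)).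
    lra. }
  assert (Bends : stiffness phi (2 * F) a1 b1 - stiffness phi (2 * F) aK bK
    <= M * (sqrt (norm a1 ^ 2 + norm aK ^ 2) * sqrt S)).
  { pose proof (Rle_trans _ _ _ (Rle_abs _) (SB a1 b1)).
    pose proof (Rle_trans _ _ _ (Rcomplements.Rabs_maj2 _) (SB aK bK)).
    apply Rle_trans with (M * (norm a1 * norm b1 + norm aK * norm bK)); [lra|].
    apply Rmult_le_compat_l; [exact HM|].
    eapply Rle_trans; [|apply Rmult_le_compat_l; [apply sqrt_pos|apply sqrt_le_1_alt, Sends]].
    pose proof (cauchy_schwarz_step (norm a1 ^ 2) (norm b1 ^ 2) (norm aK) (norm bK)
                  (pow2_ge_0 _) (pow2_ge_0 _)) as H1.
    now rewrite !sqrt_pow2 in H1 by apply norm_ge_0. }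
  assert (Btail : - sumZ (fun l => stiffness phi (2 * F) (bdiff N a (l + 1)%Z) (b l)) (K + 2) N
    <= M * (sqrt T * sqrt S)).
  { apply Rle_trans with
      (M * sumZ (fun l => norm (bdiff N a (l + 1)%Z) * norm (b l)) (K + 2) N).
    - replace (- sumZ _ _ _) with ((-1) * sumZ
        (fun l => stiffness phi (2 * F) (bdiff N a (l + 1)%Z) (b l)) (K + 2) N) by ring.
      rewrite <- !sumZ_scal; apply sumZ_le; intros l.
      pose proof (Rle_trans _ _ _ (Rcomplements.Rabs_maj2 _) (SB (bdiff N a (l + 1)%Z) (b l))).
      lra.
    - apply Rmult_le_compat_l; [exact HM|].
      eapply Rle_trans; [apply cauchy_schwarz_sumZ|].
      apply Rmult_le_compat_l; [apply sqrt_pos|apply sqrt_le_1_alt, Stail]. }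
  rewrite <- Rmult_plus_distr_l, !sqrt_mult; try lra.
  2: pose proof (pow2_ge_0 (norm a1)); pose proof (pow2_ge_0 (norm aK)); lra.
  pose proof (sqrt_sqrt h ltac:(lra)) as Eh.
  set (X := sqrt (norm a1 ^ 2 + norm aK ^ 2)) in *.
  (* Each weighted norm carries a [sqrt h]. Their product, with the explicit factor [h], matches the
     [h^2] left over after the summation by parts. *)
  replace (M * h * (sqrt h * X + h * (sqrt h * sqrt T)) * (sqrt h * sqrt S))
    with ((sqrt h * sqrt h) * h * (M * (X * sqrt S) + h * (M * (sqrt T * sqrt S)))) by ring.
  rewrite Eh; replace (h ^ 2) with (h * h) by ring.
  apply Rmult_le_compat_l; [nra|].
  apply Rplus_le_compat; [exact Bends|].
  rewrite <- Ropp_mult_distr_r_reverse.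
  apply Rmult_le_compat_l; [lra|exact Btail].
Qed.

(** * The error estimate *)

Theorem theorem10p8 (phi : R -> R) (N K : nat) (F c : R)
    (f ua uqnl : chain)
    (hphi : C2_pos phi)
    (hF : 0 < F)
    (hK : (1 < K)%nat)
    (hKN : (K < N)%nat)
    (hf : in_U N f)
    (hua : in_U N ua)
    (huqnl : in_U N uqnl)
    (eq_a : forall v : chain, in_U N v ->
       var1 (Ea N phi) (straight_chain N F c) v
       + var2 (Ea N phi) (straight_chain N F c) ua v = inner N f v)
    (eq_qnl : forall v : chain, in_U N v ->
       var1 (EQNL N K phi) (straight_chain N F c) v
       + var2 (EQNL N K phi) (straight_chain N F c) uqnl v = inner N f v)
    (hphi1 : 0 <= Derive phi (2 * F))
    (hphi2 : Derive_n phi 2 (2 * F) <= 0)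
    (hgamma : 0 < gamma4 phi F) :
  l2norm N (bdiff N (cminus ua uqnl))
  <= Cconst phi F * eps N *
     (sqrt (eps N * norm (bdiffn N 2 ua 1%Z) ^ 2
            + eps N * norm (bdiffn N 2 ua (Z.of_nat K + 2)%Z) ^ 2)
      + eps N *
        sqrt (eps N *
              sumZ (fun l => norm (bdiffn N 3 ua (l + 1)%Z) ^ 2) (K + 2) N)).
Proof.
  pose proof (eps_pos N ltac:(lia)) as Heps.
  set (e := cminus ua uqnl).
  assert (He : in_U N e) by now apply in_U_cminus.
  specialize (eq_a e He); specialize (eq_qnl e He).
  rewrite variations_Ea in eq_a by (assumption || lia).
  rewrite variations_EQNL in eq_qnl by (assumption || lia).
  pose proof (hess_qnl_coercive phi N K F e hF hKN (proj1 He) hphi1 hphi2) as Hco.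
  pose proof (consistency_bound phi N K F ua e ltac:(lia) hKN (proj1 hua) (proj1 He)) as Hcb.
  (* Both [hess_a] at [(ua, e)] and [hess_qnl] at [(uqnl, e)] equal the load tested with [e], so the
     consistency error tested with [e] is the energy of [e]. *)
  replace (hess_qnl N K phi F ua e - hess_a N phi F ua e)
    with (hess_qnl N K phi F e e) in Hcb
    by (unfold e at 1; rewrite hess_qnl_cminus; lra).
  assert (Hin : 0 <= inner N (bdiff N e) (bdiff N e)).
  { apply Rmult_le_pos; [lra|apply sumZ_nonneg; intros; apply dot_ge_0]. }
  replace (inner N (bdiff N e) (bdiff N e))
    with (l2norm N (bdiff N e) * l2norm N (bdiff N e)) in Hco
    by (now apply sqrt_sqrt).
  assert (Hn : 0 <= l2norm N (bdiff N e)) by apply sqrt_pos.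
  unfold Cconst; rewrite !(Rmult_assoc (/ gamma4 phi F)).
  set (n := l2norm N (bdiff N e)) in *.
  set (R0 := Rmax _ _ * eps N * _) in *.
  assert (HR0 : 0 <= R0).
  { unfold R0; repeat apply Rmult_le_pos; try lra.
    - eapply Rle_trans; [apply Rabs_pos|apply Rmax_l].
    - apply Rplus_le_le_0_compat; [apply sqrt_pos|].
      apply Rmult_le_pos; [lra|apply sqrt_pos]. }
  apply Rmult_le_reg_l with (gamma4 phi F); [exact hgamma|].
  rewrite <- Rmult_assoc, Rinv_r, Rmult_1_l by lra.
  (* Coercivity and consistency give [gamma4 n^2 <= R0 n]. For [n > 0] one factor cancels; for
     [n = 0] the claim is [0 <= R0]. *)
  destruct Hn as [Hn|<-]; [|lra].
  apply Rmult_le_reg_r with n; [exact Hn|lra].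
Qed.
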